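(* Let $p$ and $q$ be coprime integers with $p\ge 3$ and $q\ge 2$. The twisted torus knots $K(p,q,r,m,\pm1)$ with $2\le r\le p+q$ that are hyper-Seifert fibered with respect to $H$ and primitive with respect to $H'$ are those with $|m|>1$ and with $(p,q,r)$, up to interchanging $p$ and $q$, a triple of one of the following types: \begin{enumerate} \item $(p,q,p+q)$, \item $(p,q,p-q)$, \item $\left(2ij+i+j+\frac{1+\delta}{2},\ 2j+1,\ 2ij+i+j+\frac{1-\delta}{2}\right)$, where $\delta=\pm1$, $i\ge 0$, $j\ge 1$ are integers, \item $\left(3j+1+\frac{1+\varepsilon}{2},\ 2j+1,\ 4j+2+\varepsilon\right)$, where $\varepsilon=\pm1$ and $j\ge 1$ is an integer, or \item $(2jk+k+2\varepsilon,\ 2j+1,\ 2jk+k+\varepsilon)$, where $\varepsilon=\pm1$, $j\ge1$, $k\ge 1$ are integers, and $(j,k,\varepsilon)\ne(1,1,-1)$. \end{enumerate}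
   Context: Twisted torus knots. Let $p,q\ge 2$ be relatively prime integers, $m,n$ relatively prime nonzero integers, and $r$ an integer with $2\le r\le p+q$. Let $D$ be a disk in the standard torus in $S^3$ meeting the torus knot $T(p,q)$ in $r$ adjacent parallel arcs. Take another standard torus containing $r$ parallel copies of the torus knot $T(m,n)$ and a disk $D'$ in it meeting each of the $r$ components in one arc. Excise $D$ and $D'$ and glue the two once-punctured tori along $\partial D$ and $\partial D'$ so that the $2r$ endpoints match and the result is a coherently oriented curve. The resulting knot is $K(p,q,r,m,n)$. The knot $K=K(p,q,r,m,n)$ lies on a genus 2 Heegaard surface of $S^3$ bounding genus 2 handlebodies $H$ and $H'$. Here $H=V\natural W$ and $H'=V'\natural W'$ are boundary connected sums, where $V,V'$ are the complementary solid tori bounded by the torus containing $T(p,q)$ (with $T(p,q)$ winding $p$ times along the core of $V$ and $q$ times along that of $V'$) and $W,W'$ are those bounded by the torus containing $T(m,n)$ (with $T(m,n)$ winding $m$ times along the core of $W$ and $n$ times along that of $W'$). $K$ is primitive with respect to $H'$ if attaching a 2-handle to $H'$ along $K$ yields a solid torus, equivalently if $K$ represents a primitive element of the free group $\pi_1(H')$. Following Dean, $K(p,q,r,m,n)$ is hyper-Seifert fibered with respect to $H$ when $|m|>1$ and $r\equiv\pm1$ or $r\equiv\pm q\pmod p$. *)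

(* Defs.v *)
From HB Require Import structures.
From mathcomp Require Import all_boot all_order all_algebra.

Set Implicit Arguments.
Unset Strict Implicit.
Unset Printing Implicit Defensive.

Import Order.TTheory GRing.Theory Num.Theory.

(* (t, true) stands for the generator t and (t, false) for its inverse. *)
Definition letter_inv (T : Type) (a : T * bool) : T * bool := (a.1, ~~ a.2).

Definition reduced (T : eqType) (w : seq (T * bool)) : bool :=
  sorted (fun a b => b != letter_inv a) w.

Record freegroup (T : choiceType) : Type := FreeGroup
  { fgword :> seq (T * bool); _ : reduced fgword }.

HB.instance Definition _ (T : choiceType) := [isSub for @fgword T].
HB.instance Definition _ (T : choiceType) := [Choice of freegroup T by <:].

(* The reduced form of a :: w, when w is reduced. *)
Definition push (T : eqType) (a : T * bool) (w : seq (T * bool)) :=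
  if w is b :: w' then if b == letter_inv a then w' else a :: w else [:: a].

Lemma letter_invK (T : Type) : involutive (@letter_inv T).
Proof. by case=> t b; rewrite /letter_inv /= negbK. Qed.

Lemma reduced_behead (T : eqType) a (w : seq (T * bool)) :
  reduced (a :: w) -> reduced w.
Proof. exact: path_sorted. Qed.

Lemma push_reduced (T : eqType) a (w : seq (T * bool)) :
  reduced w -> reduced (push a w).
Proof.
case: w => //= b w Hw; case: eqP => [_|/eqP Hb]; first exact: reduced_behead Hw.
by rewrite /reduced /= Hb.
Qed.

Lemma foldr_push_reduced (T : eqType) (u v : seq (T * bool)) :
  reduced v -> reduced (foldr (@push T) v u).
Proof. by move=> Hv; elim: u => //= a u IH; exact: push_reduced. Qed.

Lemma foldr_push_id (T : eqType) (u : seq (T * bool)) :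
  reduced u -> foldr (@push T) [::] u = u.
Proof.
elim: u => //= a u IH Hu; rewrite IH ?(reduced_behead Hu) //.
by case: u Hu {IH} => //= b u /andP[/negPf-> _].
Qed.

Lemma pushK (T : eqType) a (w : seq (T * bool)) :
  reduced w -> push (letter_inv a) (push a w) = w.
Proof.
case: w => [|b w] /= Hw; first by rewrite letter_invK eqxx.
case: eqP => [Eb|_] /=; last by rewrite letter_invK eqxx.
case: w Hw => [|c w] /=; first by rewrite Eb.
by move=> /andP[/negPf Hc _]; rewrite -Eb Hc.
Qed.

Lemma pushVK (T : eqType) a (w : seq (T * bool)) :
  reduced w -> push a (push (letter_inv a) w) = w.
Proof. by move=> Hw; rewrite -{1}[a]letter_invK pushK. Qed.

Lemma foldr_push_push (T : eqType) a (u v : seq (T * bool)) :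
  reduced v ->
  foldr (@push T) v (push a u) = push a (foldr (@push T) v u).
Proof.
move=> Hv; case: u => //= b u; case: eqP => //= ->.
by rewrite pushVK // foldr_push_reduced.
Qed.

Lemma foldr_pushA (T : eqType) (u v w : seq (T * bool)) : reduced w ->
  foldr (@push T) w (foldr (@push T) v u) =
  foldr (@push T) (foldr (@push T) w v) u.
Proof. by move=> Hw; elim: u => //= a u IH; rewrite foldr_push_push // IH. Qed.

Definition fgone (T : choiceType) : freegroup T := @FreeGroup T [::] isT.

Definition fgmul (T : choiceType) (u v : freegroup T) : freegroup T :=
  FreeGroup (@foldr_push_reduced T u v (valP v)).

Lemma reduced_inv (T : eqType) (w : seq (T * bool)) :
  reduced w -> reduced (rev (map (@letter_inv T) w)).
Proof.
rewrite /reduced rev_sorted sorted_map; apply: sub_sorted => a b /=.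
by rewrite letter_invK eq_sym.
Qed.

Definition fginv (T : choiceType) (u : freegroup T) : freegroup T :=
  FreeGroup (@reduced_inv T u (valP u)).

Lemma fgmulA (T : choiceType) : associative (@fgmul T).
Proof. by move=> u v w; apply: val_inj; rewrite /= foldr_pushA // (valP w). Qed.

Lemma fgmul1 (T : choiceType) : left_id (fgone T) (@fgmul T).
Proof. by move=> u; exact: val_inj. Qed.

Lemma fgmulr1 (T : choiceType) : right_id (fgone T) (@fgmul T).
Proof. by move=> u; apply: val_inj; rewrite /= foldr_push_id // (valP u). Qed.

Lemma foldr_push_inv (T : eqType) (u v : seq (T * bool)) : reduced v ->
  foldr (@push T) (foldr (@push T) v u) (rev (map (@letter_inv T) u)) = v.
Proof.
move=> Hv; elim: u => //= a u IH.
by rewrite rev_cons foldr_rcons pushK ?IH // foldr_push_reduced.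
Qed.

Lemma fgmulV (T : choiceType) : left_inverse (fgone T) (@fginv T) (@fgmul T).
Proof.
move=> u; apply: val_inj => /=.
by rewrite -{1}(foldr_push_id (valP u)) foldr_push_inv.
Qed.

Lemma fginvK (T : choiceType) : involutive (@fginv T).
Proof.
by move=> u; apply: val_inj; rewrite /= map_rev revK (mapK (@letter_invK T)).
Qed.

Lemma fgmulrV (T : choiceType) : right_inverse (fgone T) (@fginv T) (@fgmul T).
Proof. by move=> u; rewrite -{1}[u]fginvK fgmulV. Qed.

HB.instance Definition _ (T : choiceType) := isGroup.Build (freegroup T)
  (@fgmulA T) (@fgmul1 T) (@fgmulr1 T) (@fgmulV T) (@fgmulrV T).

Definition fggen (T : choiceType) (t : T) : freegroup T :=
  @FreeGroup T [:: (t, true)] isT.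

(* w belongs to some free basis of the free group; the free bases are the
   images of the standard basis under the automorphisms. *)
Definition primitive (T : choiceType) (w : freegroup T) : Prop :=
  exists (f : {multiplicative freegroup T -> freegroup T}) (t : T),
    bijective f /\ f (fggen t) = w.

(* Meridian disks of the four solid tori V, V', W, W'.  The disks of V and W
   form a complete disk system of H = V \natural W, those of V' and W' one of
   H' = V' \natural W', and all of them are disjoint from D = D'. *)
Variant meridian_disk := Disk_V | Disk_V' | Disk_W | Disk_W'.

(* A transverse crossing of a meridian disk by an oriented curve on the
   surface, with its sign (true is positive). *)
Definition crossing : Type := meridian_disk * bool.

(* Let p, q >= 0 be coprime and write the torus as R^2/Z^2, with T(p,q) the
   line of slope (p, q) and the two meridians the edges of the unit square:
   the vertical edge is the meridian A, crossed p times, and the horizontal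
   one is the meridian B, crossed q times.  The antidiagonal of the square
   meets T(p,q) in p + q points, numbered 0, ..., p + q - 1 from the corner
   (0, 1) to the corner (1, 0).  Following T(p,q) from the point k to its next
   meeting with the antidiagonal, one crosses B if k < q and A otherwise, and
   arrives at the point k + p modulo p + q. *)
Definition strand (p q i : nat) : nat := (i * p) %% (p + q).

(* The crossing made on T(m,n) between its i-th and (i+1)-st passages through
   the antidiagonal; if m or n is negative the corresponding coordinate of the
   torus is reversed. *)
Definition strand_crossing (A B : meridian_disk) (m n : int) (i : nat)
    : crossing :=
  if strand `|m| `|n| i < `|n| then (B, (0 < n)%R) else (A, (0 < m)%R).

Definition torus_knot (A B : meridian_disk) (m n : int) : seq crossing :=
  [seq strand_crossing A B m n i | i <- iota 0 (`|m| + `|n|)].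

(* K(p,q,r,m,n) as the cyclic sequence of its crossings with the meridian
   disks.  The disk D is a neighbourhood of the part of the antidiagonal that
   contains the points 0, ..., r - 1: it meets T(p,q) in r adjacent parallel
   arcs, and r can be any integer up to p + q.  The curve follows T(p,q), and
   whenever it meets D it goes once around one of the r parallel copies of
   T(m,n), starting and ending at D', and leaves D where T(p,q) does. *)
Definition twisted_torus_knot (p q r : nat) (m n : int) : seq crossing :=
  flatten
    [seq (if strand p q i < r then torus_knot Disk_W Disk_W' m n else [::])
           ++ [:: strand_crossing Disk_V Disk_V' p q i]
    | i <- iota 0 (p + q)].

(* pi_1(H') is the free group on the cores of V' (the generator true) and
   W' (the generator false), dual to the two meridian disks of H'; crossing
   the disks of V and W contributes nothing. *)
Definition pi1_H'_letter (c : crossing) : freegroup bool :=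
  let: (d, s) := c in
  match d with
  | Disk_V' => if s then fggen true else (fggen true)^-1
  | Disk_W' => if s then fggen false else (fggen false)^-1
  | _ => 1
  end%g.

(* A closed curve determines its class in pi_1(H') up to conjugation, to which
   primitivity is insensitive. *)
Definition pi1_H'_class (c : seq crossing) : freegroup bool :=
  (\prod_(x <- c) pi1_H'_letter x)%g.

Definition primitive_wrt_H' (p q r : nat) (m n : int) : Prop :=
  primitive (pi1_H'_class (twisted_torus_knot p q r m n)).

Local Open Scope ring_scope.

(* Dean's notion: it is by definition this condition on the parameters, and
   does not involve n. *)
Definition hyper_Seifert_wrt_H (p q r : nat) (m n : int) : Prop :=
  1 < `|m| /\
  [\/ (r = 1 %[mod p])%Z, (r = - 1 %[mod p])%Z,
      (r = q %[mod p])%Z | (r = - q%:Z %[mod p])%Z].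

Definition is_sign (e : int) : Prop := e = 1 \/ e = - 1.

Definition listed_triple (t : int * int * int) : Prop :=
  [\/ exists p q : int, t = (p, q, p + q),
      exists p q : int, t = (p, q, p - q)
    | [\/ exists d i j : int, [/\ is_sign d, 0 <= i, 1 <= j &
            t = (2 * i * j + i + j + ((1 + d) %/ 2)%Z, 2 * j + 1,
                 2 * i * j + i + j + ((1 - d) %/ 2)%Z)],
          exists e j : int, [/\ is_sign e, 1 <= j &
            t = (3 * j + 1 + ((1 + e) %/ 2)%Z, 2 * j + 1, 4 * j + 2 + e)]
        | exists e j k : int, [/\ is_sign e, 1 <= j, 1 <= k,
            (j, k, e) <> (1, 1, - 1) &
            t = (2 * j * k + k + 2 * e, 2 * j + 1, 2 * j * k + k + e)]]].

(* Main.v *)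
(* In the generators dual to the disks of V' and W', the curve is the product
   over the (p + q)-cycle 0, p, 2p, ... of y^[s < r] x^[s < q].  Cutting it at
   the letters x and substituting x -> y^(-k) x, k = r / q, leaves the product
   over j < q of y^[j p mod q < r mod q] x, so the question is whether a word
   recording the visits of a rotation of Z/q to an interval is primitive.

   The abelianized Fox derivatives of a primitive element have no common zero.
   Along the curve x = t^r, y = t^(-q) this forces the heights of the letters
   x to be q consecutive integers: the word is the balanced one, in which y
   records the visits of the rotation by r to an interval of length r.
   Comparing, an interval is mapped onto an interval by the multiplication by
   r / p, which leaves r = 1, -1, p or -p modulo q; in these cases the word is
   reduced to a generator by the Euclidean algorithm.

   Hence both conditions on K are congruences, exchanged by p <-> q, and they
   are solved by bounding the quotients. *)
Require Import Defs.
From HB Require Import structures.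
From mathcomp Require Import all_boot all_order all_algebra all_field.
From mathcomp Require Import zify ring.

Set Implicit Arguments.
Unset Strict Implicit.
Unset Printing Implicit Defensive.

Import Order.TTheory GRing.Theory Num.Theory.

(** * Morphisms out of a free group *)

Section FreeGroupMorphisms.
Local Open Scope group_scope.
Variable T : choiceType.
Implicit Types (u v w : freegroup T) (t : T).

Lemma freegroup_ind (P : freegroup T -> Prop) :
  P 1 -> (forall t w, P w -> P (fggen t * w)) ->
  (forall t w, P w -> P ((fggen t)^-1 * w)) -> forall w, P w.
Proof.
move=> P1 PM PV [w w_red]; elim: w w_red => [|[t b] w IH] w_red.
  by rewrite (_ : FreeGroup _ = 1) //; exact: val_inj.
have w_red' := reduced_behead w_red; have Pw := IH w_red'.
have -> : FreeGroup w_red = (if b then fggen t else (fggen t)^-1)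
                            * FreeGroup w_red'.
  apply: val_inj => /=; rewrite -[LHS](foldr_push_id w_red) /=.
  by case: b {w_red} => /=; rewrite !foldr_push_id.
by case: b {w_red} => /=; [apply: PM | apply: PV].
Qed.

Section Lift.
Variables (M : monoidType) (f fV : T -> M).
Hypotheses (ffV : forall t, f t * fV t = 1) (fVf : forall t, fV t * f t = 1).

Definition lift_letter (a : T * bool) := if a.2 then f a.1 else fV a.1.

(* The proofs are arguments so that the instance below can be inferred. *)
Definition fglift of (forall t, f t * fV t = 1) & (forall t, fV t * f t = 1) :=
  fun w => \prod_(a <- fgword w) lift_letter a.

Lemma fgliftM : {morph fglift ffV fVf : u v / u * v}.
Proof.
move=> [u u_red] v; rewrite /fglift /= {u_red}.
elim: u => [|a u IH] /=; first by rewrite big_nil mul1g.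
rewrite big_cons -mulgA -{}IH.
case: (foldr _ _ u) => [|b w] /=; first by rewrite big_cons.
case: eqP => [->|_]; last by rewrite big_cons.
by rewrite big_cons mulgA; case: a => t [] /=; rewrite /lift_letter /= ?ffV ?fVf mul1g.
Qed.

HB.instance Definition _ := isMultiplicative.Build _ _ (fglift ffV fVf) fgliftM.

Lemma fglift1 : fglift ffV fVf 1 = 1.
Proof. by rewrite /fglift big_nil. Qed.

Lemma fglift_gen t : fglift ffV fVf (fggen t) = f t.
Proof. by rewrite /fglift big_seq1. Qed.

End Lift.

(** In a monoid a multiplicative map need only send 1 to an idempotent, hence the two hypotheses on
    1. *)
Lemma multiplicative_ext (M : monoidType)
    (f g : {multiplicative freegroup T -> M}) :
  f 1 = 1 -> g 1 = 1 -> (forall t, f (fggen t) = g (fggen t)) -> f =1 g.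
Proof.
move=> f1 g1 fg; elim/freegroup_ind => [|t w IH|t w IH].
- by rewrite f1 g1.
- by rewrite !gmulfM fg IH.
rewrite !gmulfM IH; congr (_ * _).
rewrite -[LHS]mulg1 -g1 -(mulgV (fggen t)) gmulfM -fg mulgA -gmulfM mulVg f1.
by rewrite mul1g.
Qed.

End FreeGroupMorphisms.

Lemma multiplicative1 (G H : groupType) (f : {multiplicative G -> H}) :
  (f 1 = 1)%g.
Proof. by apply: (mulgI (f 1%g)); rewrite -gmulfM !mulg1. Qed.

Lemma multiplicativeV (G H : groupType) (f : {multiplicative G -> H}) x :
  (f x^-1 = (f x)^-1)%g.
Proof. by apply/esym/mulg1_eq; rewrite -gmulfM mulgV multiplicative1. Qed.

(** * Bases of the free group of rank 2 and Nielsen moves *)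

Section Bases.
Local Open Scope group_scope.
Local Notation F2 := (freegroup bool).
Implicit Types (a b g w : F2).

Definition basis a b := exists f : {multiplicative F2 -> F2},
  [/\ bijective f, f (fggen true) = a & f (fggen false) = b].

Definition lift2 a b : {multiplicative F2 -> F2} :=
  let f t := if t then a else b in
  fglift (fun t => mulgV (f t)) (fun t => mulVg (f t)).

Lemma lift2_x a b : lift2 a b (fggen true) = a.
Proof. exact: fglift_gen. Qed.

Lemma lift2_y a b : lift2 a b (fggen false) = b.
Proof. exact: fglift_gen. Qed.

Lemma F2_endo_id (f : {multiplicative F2 -> F2}) :
  f (fggen true) = fggen true -> f (fggen false) = fggen false -> f =1 id.
Proof.
move=> fx fy; apply: (@multiplicative_ext _ _ f idfun); rewrite ?multiplicative1 //.
by case.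
Qed.

Lemma basis_gen : basis (fggen true) (fggen false).
Proof. by exists idfun; split=> //; exists idfun. Qed.

Lemma basis_primitive a b : basis a b -> primitive a.
Proof. by case=> f [f_bij fx fy]; exists f, true. Qed.

(* The substitutions x -> u, y -> v and x -> u', y -> v' are mutually inverse. *)
Lemma basis_subst (u v u' v' : F2) a b :
  lift2 u v u' = fggen true -> lift2 u v v' = fggen false ->
  lift2 u' v' u = fggen true -> lift2 u' v' v = fggen false ->
  basis a b -> basis (lift2 a b u) (lift2 a b v).
Proof.
move=> e1 e2 e3 e4 [f [f_bij fx fy]].
have fE : f =1 lift2 a b.
  apply: multiplicative_ext; rewrite ?multiplicative1 //.
  by case; rewrite ?lift2_x ?lift2_y.
exists (f \o lift2 u v); split; first apply: bij_comp => //.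
- exists (lift2 u' v') => w.
    by apply: (@F2_endo_id (lift2 u' v' \o lift2 u v)); rewrite /= ?lift2_x ?lift2_y.
  by apply: (@F2_endo_id (lift2 u v \o lift2 u' v')); rewrite /= ?lift2_x ?lift2_y.
- by rewrite /= lift2_x fE.
- by rewrite /= lift2_y fE.
Qed.

Let liftE a b := (@gmulfM _ _ (lift2 a b), @multiplicativeV _ _ (lift2 a b),
  lift2_x a b, lift2_y a b).

Lemma basis_swap a b : basis a b -> basis b a.
Proof.
move=> ab; pose x := fggen true; pose y := fggen false.
have := @basis_subst y x y x a b; rewrite !liftE; exact.
Qed.

Lemma basisVr a b : basis a b -> basis a b^-1.
Proof.
move=> ab; pose x := fggen true; pose y := fggen false.
have := @basis_subst x y^-1 x y^-1 a b; rewrite !liftE invgK; exact.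
Qed.

Lemma basisMl a b : basis a b -> basis (b * a) b.
Proof.
move=> ab; pose x := fggen true; pose y := fggen false.
have := @basis_subst (y * x) y (y^-1 * x) y a b.
by rewrite !liftE mulKg mulVKg; exact.
Qed.

Lemma basisXl a b n : basis a b -> basis (b ^+ n * a) b.
Proof.
move=> ab; elim: n => [|n IH]; first by rewrite mul1g.
by rewrite expgS -mulgA; exact: basisMl.
Qed.

Lemma primitive_endo (f : {multiplicative F2 -> F2}) w :
  bijective f -> primitive (f w) <-> primitive w.
Proof.
move=> f_bij; split=> [[g [t [g_bij gt]]]|[g [t [g_bij gt]]]]; last first.
  by exists (f \o g), t; split; [exact: bij_comp | rewrite /= gt].
case: f_bij => f' fK f'K.
have f'M := can2_gmulfM fK f'K.
pose f'' : {multiplicative F2 -> F2} := HB.pack f' (isMultiplicative.Build _ _ f' f'M).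
exists (f'' \o g), t; split; first by apply: bij_comp => //; exists f.
by rewrite /= gt fK.
Qed.

Lemma primitiveJ w g : primitive (w ^ g) <-> primitive w.
Proof.
have JM : {morph conjg^~ g : u v / u * v} by move=> u v; rewrite conjMg.
pose f : {multiplicative F2 -> F2} :=
  HB.pack (conjg^~ g) (isMultiplicative.Build _ _ (conjg^~ g) JM).
apply: (@primitive_endo f).
by exists (conjg^~ g^-1); [exact: conjgK | exact: conjgKV].
Qed.

Lemma primitiveC a b : primitive (a * b) <-> primitive (b * a).
Proof. by have := primitiveJ (b * a) b; rewrite conjgE -mulgA mulKg. Qed.

End Bases.

(** * Affine representations, in place of Fox derivatives *)

Section AffineCocycle.
Local Open Scope ring_scope.
Variable R : fieldType.

(* The pair (c, d) is the affine map z |-> c z + d, so that a morphism from a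
   group is a character together with a 1-cocycle twisted by it. *)
Definition affine := (R * R)%type.
Implicit Types u v : affine.

HB.instance Definition _ := Choice.on affine.

Definition affine_mul u v : affine := (u.1 * v.1, u.2 + u.1 * v.2).
Definition affine_one : affine := (1, 0).

Lemma affine_mulA : associative affine_mul.
Proof. by move=> u v w; congr (_, _) => /=; ring. Qed.

Lemma affine_mul1 : left_id affine_one affine_mul.
Proof. by case=> c d; congr (_, _) => /=; ring. Qed.

Lemma affine_mulr1 : right_id affine_one affine_mul.
Proof. by case=> c d; congr (_, _) => /=; ring. Qed.

HB.instance Definition _ :=
  isMonoid.Build affine affine_mulA affine_mul1 affine_mulr1.

Lemma affine_mulE u v : (u * v)%g = (u.1 * v.1, u.2 + u.1 * v.2).
Proof. by []. Qed.

Implicit Types c d : R.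

Lemma affine_mulV c d : c != 0 -> affine_mul (c, d) (c^-1, - (c^-1 * d)) = affine_one.
Proof.
by move=> c0; congr (_, _) => /=; field.
Qed.

Lemma affine_mulVr c d : c != 0 -> affine_mul (c^-1, - (c^-1 * d)) (c, d) = affine_one.
Proof.
by move=> c0; congr (_, _) => /=; field.
Qed.

Definition cocycle (c d : bool -> R) (c0 : forall t, c t != 0) :
    {multiplicative freegroup bool -> affine} :=
  fglift (fun t => affine_mulV (d t) (c0 t)) (fun t => affine_mulVr (d t) (c0 t)).

Definition character_part u : affine := (u.1, 0).

Lemma character_partM : {morph character_part : u v / (u * v)%g}.
Proof. by move=> u v; rewrite !affine_mulE mulr0 addr0. Qed.

HB.instance Definition _ :=
  isMultiplicative.Build affine affine character_part character_partM.

(* With f an automorphism mapping a generator to w, transport along f the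
   cocycle that is 1 on this generator and 0 on the other one. *)
Lemma primitive_cocycle (X Y : R) (w : freegroup bool) :
  X != 0 -> Y != 0 -> primitive w ->
  exists E : {multiplicative freegroup bool -> affine},
    [/\ E 1%g = 1%g, (E (fggen true)).1 = X, (E (fggen false)).1 = Y
      & (E w).2 = 1].
Proof.
move=> X0 Y0 [f [t0 [[g fK gK] ft0]]].
pose c t := if t then X else Y.
have c0 t : c t != 0 by case: t.
pose chi := cocycle (fun=> 0) c0.
have chi1 : chi 1%g = 1%g := fglift1 _ _.
have f1 := multiplicative1 f.
have chi_neq0 s : (chi s).1 != 0.
  have := congr1 fst (@gmulfM _ _ chi s s^-1%g).
  rewrite mulgV chi1 affine_mulE /= => /eqP; apply: contraTneq => ->.
  by rewrite mul0r oner_eq0.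
(* The character of [E'] must be that of [chi \o f], so that transport along f turns it into
   [chi]. *)
pose E' := cocycle (fun t => (t == t0)%:R) (fun t => chi_neq0 (f (fggen t))).
have E'1 : E' 1%g = 1%g := fglift1 _ _.
have E'gen t : E' (fggen t) = ((chi (f (fggen t))).1, (t == t0)%:R) := fglift_gen _ _ _.
have E'chi s : (E' s).1 = (chi (f s)).1.
  suff /(congr1 fst) : (character_part \o E') s
                     = (character_part \o (chi \o f)) s by [].
  apply: (@multiplicative_ext _ _ (character_part \o E')
            (character_part \o (chi \o f))) => [||t] /=.
  - by rewrite E'1.
  - by rewrite f1 chi1.
  - by rewrite E'gen.
pose g' : {multiplicative freegroup bool -> freegroup bool} :=
  HB.pack g (isMultiplicative.Build _ _ g (can2_gmulfM fK gK)).
exists (E' \o g'); split=> /=.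
- by rewrite (multiplicative1 g' : g 1%g = 1%g).
- by rewrite E'chi gK /chi [cocycle _ _ _]fglift_gen.
- by rewrite E'chi gK /chi [cocycle _ _ _]fglift_gen.
by rewrite -ft0 fK E'gen eqxx.
Qed.

End AffineCocycle.

(** * Heights of the letters of a primitive word *)

Section BalancedWords.
Local Open Scope ring_scope.
Variables (q : nat) (eps : nat -> bool).

Local Notation x := (fggen true).
Local Notation y := (fggen false).

Definition bit_word (a b : freegroup bool) : freegroup bool :=
  (\prod_(0 <= j < q) (b ^+ eps j * a))%g.

Let E i := (\sum_(0 <= j < i) eps j)%N.
Let r := E q.

Let ES i : E i.+1 = (E i + eps i)%N.
Proof. by rewrite /E big_nat_recr. Qed.

Let E_le i : (i <= q)%N -> (E i <= r)%N.
Proof.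
by move=> iq; rewrite /r /E (big_cat_nat (leq0n i) iq) /= leq_addr.
Qed.

(* The exponent of t, shifted by q r, in the value of the character x |-> t^r,
   y |-> t^(-q) just before the j-th occurrence of x. *)
Definition height j := (q * (r - E j.+1) + r * j)%N.

(** The same exponent at the beginning of the i-th block, before its y if it has one. *)
Let start i := (q * (r - E i) + r * i)%N.

Let start_height i : (i < q)%N -> start i = (height i + q * eps i)%N.
Proof.
move=> iq; have := E_le iq; rewrite /start /height ES => ?.
have -> : (r - E i = r - (E i + eps i) + eps i)%N by lia.
by rewrite mulnDr; lia.
Qed.

Let startS i : start i.+1 = (height i + r)%N.
Proof. by rewrite /start /height mulnS; lia. Qed.

Section Evaluation.
Variables (R : fieldType) (t : R).

Definition x_heights := \sum_(0 <= j < q) t ^+ height j.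
Definition y_heights := \sum_(0 <= j < q) (eps j)%:R * t ^+ height j.

(** Some cocycle takes the value 1 on the word. By the product rule this value is, up to a power of
    t, a linear combination of the two sums, so they cannot both vanish. *)
Lemma primitive_heights :
  t != 0 -> primitive (bit_word x y) -> x_heights = 0 -> y_heights <> 0.
Proof.
move=> t0 w_prim xh0 yh0.
have tn0 n : t ^+ n != 0 by rewrite expf_neq0.
have tVn0 n : (t ^+ n)^-1 != 0 by rewrite invr_eq0.
have [c [c1 cx cy cw]] := primitive_cocycle (tn0 r) (tVn0 q) w_prim.
pose u i := c (\prod_(0 <= j < i) (y ^+ eps j * x))%g.
pose al := (c x).2; pose be := (c y).2.
(* The factor t^(q r) keeps exponents natural. A letter y of block j is read at [start j], which is
   then [height j + q], whence t^q. *)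
have u_val i : (i <= q)%N -> t ^+ (q * r) * (u i).1 = t ^+ start i /\
   t ^+ (q * r) * (u i).2
   = \sum_(0 <= j < i) t ^+ height j * (al + (eps j)%:R * t ^+ q * be).
  elim: i => [_|i IH iq].
    rewrite /u !big_geq // c1 /= mulr0 mulr1; split=> //.
    by rewrite /start /E big_geq // subn0 muln0 addn0.
  have [IH1 IH2] := IH (ltnW iq).
  rewrite /u !big_nat_recr //= gmulfM affine_mulE /= -/(u i) mulrDr !mulrA IH1 IH2.
  rewrite startS start_height //; case: (eps i) => /=.
    rewrite expg1 gmulfM affine_mulE /= cx cy -/al -/be muln1 !exprD.
    by split; [|congr (_ + _)]; field.
  rewrite mul1g cx -/al muln0 addn0 exprD; split=> //.
  by rewrite !mul0r addr0.
have [_] := u_val q (leqnn q).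
rewrite /u -/(bit_word x y) cw mulr1.
have -> : \sum_(0 <= j < q) t ^+ height j * (al + (eps j)%:R * t ^+ q * be)
        = x_heights * al + y_heights * (t ^+ q * be).
  rewrite /x_heights /y_heights !mulr_suml -big_split.
  by apply: eq_bigr => j _ /=; ring.
rewrite xh0 yh0 !mul0r addr0.
by apply/eqP.
Qed.

End Evaluation.

(** At t = 1 the two sums are q and r, which both vanish in ['F_l] for a common prime divisor l. *)
Lemma primitive_coprime : (0 < q)%N -> primitive (bit_word x y) -> coprime q r.
Proof.
move=> q0 w_prim; apply/negPn/negP => ncop.
have g1 : (1 < gcdn q r)%N by rewrite ltn_neqAle eq_sym ncop gcdn_gt0 q0.
set l := pdiv (gcdn q r); have l_pr : prime l by apply: pdiv_prime.
have l_dvd : (l %| gcdn q r)%N by apply: pdiv_dvd.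
have F0 n : (l %| n)%N -> n%:R = 0 :> 'F_l.
  move=> ln; apply/eqP; rewrite -(dvdn_pcharf (pchar_Fp l_pr)) //.
have := @primitive_heights 'F_l 1 (oner_neq0 _) w_prim.
rewrite /x_heights /y_heights.
under eq_bigr => j _ do rewrite expr1n.
under [X in _ -> X <> _]eq_bigr => j _ do rewrite expr1n mulr1.
rewrite -natr_sum big_const_nat iter_addr_0 subn0 -/r; apply.
  by rewrite F0 // (dvdn_trans l_dvd) ?dvdn_gcdl.
by rewrite F0 // (dvdn_trans l_dvd) ?dvdn_gcdr.
Qed.

(** Once the power of X is split off, the cofactor has no root, hence is constant. *)
Lemma monomialP (F : closedFieldType) (h : {poly F}) :
  h != 0 -> (forall t, root h t -> t = 0) -> exists c k, h = c *: 'X^k.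
Proof.
move=> h0 roots_h; have [k [g]] := multiplicity_XsubC h 0.
rewrite h0 subr0 /= => g0 hE; have [[t gt]|] := altP (closed_rootP g).
  have t0 : t = 0 by apply: roots_h; rewrite hE rootM gt.
  by rewrite -t0 gt in g0.
by move/negbNE/size_poly1P => [c _ gc]; exists c, k; rewrite hE gc mul_polyC.
Qed.

Let Phi n : {poly algC} := \sum_(i < n) 'X^i.

Let Phi_root n t : root (Phi n) t -> t ^+ n = 1.
Proof.
move=> /rootP pt; apply/eqP; rewrite -subr_eq0 subrX1.
have <- : (Phi n).[t] = \sum_(i < n) t ^+ i.
  by rewrite horner_sum; apply: eq_bigr => i _; rewrite hornerXn.
by rewrite pt mulr0.
Qed.

(* P and Q are the generating functions of the heights at the letters x and y.
   The fundamental formula of the Fox calculus gives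
   P (X^r - 1) = Q (X^q - 1), so P = h (1 + ... + X^(q-1)) and
   Q = h (1 + ... + X^(r-1)); primitivity forbids nonzero roots of h, which is
   thus a monomial. *)
Lemma primitive_balanced : (0 < q)%N -> primitive (bit_word x y) ->
  exists k, forall j, (j < q)%N -> (k <= height j < k + q)%N.
Proof.
move=> q0 w_prim; have cop := primitive_coprime q0 w_prim.
pose P : {poly algC} := \sum_(0 <= j < q) 'X^(height j).
pose Q : {poly algC} := \sum_(0 <= j < q) (eps j)%:R *: 'X^(height j).
have PE t : P.[t] = x_heights t.
  by rewrite horner_sum; apply: eq_bigr => i _; rewrite hornerXn.
have QE t : Q.[t] = y_heights t.
  by rewrite horner_sum; apply: eq_bigr => i _; rewrite hornerZ hornerXn.
(* The difference telescopes from [start 0] to [start q], which both equal q r. *)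
have PQ : P * ('X^r - 1) = Q * ('X^q - 1).
  apply/eqP; rewrite -subr_eq0 /P /Q !mulr_suml -sumrB; apply/eqP.
  rewrite (_ : \sum_(0 <= j < q) _ = \sum_(0 <= j < q)
     ('X^(start j.+1) - 'X^(start j))).
    by rewrite telescope_sumr // /start subnn /E big_geq // subn0 !muln0 addn0 mulnC subrr.
  apply: eq_big_nat => j /andP[_ jq]; rewrite startS start_height // !exprD.
  by case: (eps j); rewrite ?muln1 ?muln0 ?scale0r ?scale1r; ring.
have PhiE n : 'X^n - 1 = ('X - 1) * Phi n :> {poly algC} by rewrite subrX1.
have X1 : 'X - 1 != 0 :> {poly algC} by rewrite -[1]polyC1 polyXsubC_eq0.
have PhiQ : P * Phi r = Q * Phi q.
  apply: (mulfI X1); rewrite (mulrCA _ P) (mulrCA _ Q).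
  by rewrite -(PhiE r) -(PhiE q).
have Phi1 n : (Phi n).[1] = n%:R.
  rewrite horner_sum (eq_bigr (fun=> 1)) ?sumr_const ?card_ord // => i _.
  by rewrite hornerXn expr1n.
have Phi_neq0 n : (0 < n)%N -> Phi n != 0.
  move=> n0; apply/eqP => /(congr1 (fun f : {poly algC} => f.[1])).
  by rewrite Phi1 horner0; apply/eqP; rewrite pnatr_eq0 -lt0n.
have cop_Phi : coprimep (Phi q) (Phi r).
  apply/Pdiv.ClosedField.coprimepP => t Phit; apply/eqP => /rootP/Phi_root tr.
  have tq := Phi_root Phit; have [u v uv _] := egcdnP r q0.
  have := congr1 (fun n => t ^+ n) uv.
  rewrite /= exprD (eqP cop) mulnC [(v * r)%N]mulnC !exprM tq tr !expr1n mul1r => t1.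
  by move: Phit; rewrite /root -[t]t1 Phi1 pnatr_eq0 -leqn0 leqNgt q0.
have /dvdpP[h Ph] : Phi q %| P.
  by rewrite -(Gauss_dvdpl _ cop_Phi) PhiQ dvdp_mulIr.
have Qh : Q = h * Phi r.
  by apply: (mulIf (Phi_neq0 _ q0)); rewrite -PhiQ Ph mulrAC.
(* Coefficients of P are counts, so no height cancels in characteristic 0. *)
have Pcoef j : (j < q)%N -> P`_(height j) != 0.
  move=> jq; rewrite coef_sum (eq_bigr (fun i => (height j == height i)%:R)); last first.
    by move=> i _; rewrite coefXn.
  rewrite -natr_sum pnatr_eq0 -lt0n big_mkord (bigD1 (Ordinal jq)) //=.
  by rewrite eqxx.
have h0 : h != 0.
  by apply: contraTneq (Pcoef _ q0) => h0; rewrite Ph h0 mul0r coef0 eqxx.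
have [] := @monomialP _ h h0.
  move=> t /rootP ht; apply/eqP; apply: contraT => t0.
  case: (@primitive_heights _ t t0 w_prim).
    by rewrite -PE Ph hornerM ht mul0r.
  by rewrite -QE Qh hornerM ht mul0r.
move=> c [k hE]; exists k => j jq.
have := Pcoef j jq; rewrite Ph hE -scalerAl coefZ mulf_eq0 negb_or => /andP[_].
rewrite coefXnM (_ : Phi q = \poly_(i < q) 1); last first.
  by rewrite poly_def; apply: eq_bigr => i _; rewrite scale1r.
case: ltnP => [|kj]; first by rewrite eqxx.
rewrite coef_poly; case: ltnP; last by rewrite eqxx.
by lia.
Qed.

(** Cyclically, the x before the j-th one has height [height j + q * eps j - r]. Since all heights
    lie in [k, k + q), [eps j] tells whether [height j - k < r], and [height j] is r j modulo q. *)
Lemma primitive_rotation : (0 < q)%N -> primitive (bit_word x y) ->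
  exists c, forall j, (j < q)%N -> eps j = ((r * j + c) %% q < r)%N.
Proof.
(* The witness represents -k modulo q. *)
move=> q0 /(primitive_balanced q0)[k hk]; exists (q.-1 * k)%N => j jq.
have /andP[kh hq] := hk j jq.
have -> : ((r * j + q.-1 * k) %% q = height j - k)%N.
  have lt_q : (height j - k < q)%N by rewrite ltn_subLR.
  rewrite -[RHS](modn_small lt_q).
  have : ((r - E j.+1) * q + (r * j + q.-1 * k) = k * q + (height j - k))%N.
    move: kh; rewrite /height; case: (q) q0 => // q' _ /=; nia.
  by move=> /(congr1 (modn^~ q)); rewrite !modnMDl.
have [j' jq' ej] : exists2 j', (j' < q)%N & (height j' + r = height j + q * eps j)%N.
  rewrite -start_height //; case: j jq {kh hq} => [|j] jq; last first.
    by exists j; rewrite ?startS // ltnW.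
  exists q.-1; first by rewrite prednK.
  rewrite -startS prednK // /start subnn /E big_geq // subn0.
  by rewrite !muln0 addn0 mulnC.
have /andP[] := hk j' jq'.
by case: (eps j) ej => /=; rewrite ?muln1 ?muln0 => ej ? ?; apply/esym; lia.
Qed.

End BalancedWords.

(** * Rotations of Z/q and visits to an interval *)

Lemma sum_residues (q p a : nat) (F : nat -> nat) : coprime p q -> 0 < q ->
  \sum_(0 <= j < q) F ((a + j * p) %% q) = \sum_(0 <= v < q) F v.
Proof.
move=> cop q0; rewrite !big_mkord.
pose s (j : 'I_q) := Ordinal (ltn_pmod (a + j * p) q0).
have s_inj : injective s.
  move=> i j /(congr1 val) /= /eqP; rewrite eqn_modDl => /eqP e.
  apply: val_inj; wlog ij : i j e / i <= j.
    by move=> H; case/orP: (leq_total i j) => ?; [|apply/esym]; apply: H.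
  move/eqP: e; rewrite eq_sym eqn_mod_dvd ?leq_mul // -mulnBl Gauss_dvdl 1?coprime_sym //.
  rewrite /dvdn modn_small ?(leq_ltn_trans (leq_subr _ _)) // subn_eq0 => ji.
  by apply/eqP; rewrite eqn_leq ij.
by rewrite [RHS](reindex_inj s_inj).
Qed.

Lemma coprime_inverse (u q : nat) : coprime u q ->
  exists k, k * u = 1 %[mod q].
Proof.
case: u => [|u] cop.
  by move: cop; rewrite /coprime gcd0n => /eqP ->; exists 0; rewrite !modn1.
have [[a b] /= ab] := coprimeP q (ltn0Sn u) cop; exists a.
by rewrite (_ : a * u.+1 = b * q + 1) ?modnMDl //; lia.
Qed.

(* The interval [0, r) has exactly one point v with v + 1 outside of it, and
   the shift by u moves min(u, q - u, r, q - r) of its points out of it. *)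
Lemma interval_progression (q r u c : nat) :
  2 <= r -> r + 2 <= q -> coprime u q ->
  (forall v, (v %% q < r) = ((u * v + c) %% q < r)) ->
  u %% q = 1 \/ u %% q = q.-1.
Proof.
move=> r2 rq cop H; have q0 : 0 < q by lia.
set u' := u %% q; have u'q : u' < q by exact: ltn_pmod.
have sol w : w < q -> exists v, (u * v + c) %% q = w.
  move=> wq; have [k ku] := coprime_inverse cop; exists (k * (w + c * q.-1)).
  rewrite mulnA (mulnC u) -modnDml -modnMml ku modnMml modnDml mul1n -addnA.
  by rewrite -[X in _ + (_ + X)]muln1 -mulnDr addn1 prednK // addnC modnMDl modn_small.
(* A point that the shift by u moves out of [0, r) is the image of some v with v < r <= v + 1 modulo
   q, and only v = r - 1 qualifies. *)
have one_exit w1 w2 : w1 < r -> w2 < r -> r <= (w1 + u') %% q -> r <= (w2 + u') %% q -> w1 = w2.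
  have exit_at w : w < r -> r <= (w + u') %% q ->
      exists2 v, v %% q = r.-1 & (u * v + c) %% q = w.
    move=> wr wu; have [v vw] := sol w ltac:(lia); exists v => //.
    have : v %% q < r by rewrite H vw.
    have : r <= v.+1 %% q.
      by rewrite leqNgt H mulnS -addnA -modnDmr vw -modnDml addnC -leqNgt.
    rewrite -addn1 -modnDml; have := ltn_pmod v q0.
    case: (ltnP (v %% q + 1) q) => ? ?; first by rewrite modn_small //; lia.
    by rewrite (_ : v %% q + 1 = q) ?modnn; lia.
  move=> r1 r2' /(exit_at _ r1)[v1 e1 <-] /(exit_at _ r2')[v2 e2 <-].
  apply/eqP; rewrite eqn_modDr -modnMmr e1 -e2 modnMmr; exact: eqxx.
have u'0 : u' != 0.
  apply/eqP => /eqP qu; move: cop; rewrite /coprime (gcdn_idPr qu).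
  by move/eqP; lia.
case: (u' =P 1) => [|u1]; first by left.
case: (u' =P q.-1) => [|uq]; first by right.
(* In each case two distinct points leave [0, r): the last two, the first two, or those sent to q -
   1 and r. *)
exfalso; case: (leqP u' (q - r)) => uqr.
  by have := one_exit r.-1 r.-2; rewrite !modn_small; lia.
case: (leqP r u') => ru; first by have := one_exit 0 1; rewrite !modn_small; lia.
by have := one_exit (q - u').-1 (r - u'); rewrite !modn_small; lia.
Qed.

(** By [primitive_rotation] the same bits record a rotation by r visiting an interval of the same
    length r; [interval_progression] compares the two rotations. *)
Lemma primitive_rotation_word (q p r : nat) :
  1 < q -> coprime p q -> r < q ->
  primitive (bit_word q (fun j => (j.+1 * p) %% q < r)
                      (fggen true) (fggen false)) ->
  [\/ r = 1, r = q.-1, r = p %[mod q] | q %| r + p].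
Proof.
move=> q1 cop rq w_prim; have q0 := ltnW q1.
have sum_r : \sum_(0 <= j < q) ((j.+1 * p) %% q < r) = r.
  rewrite (sum_residues p (fun v => v < r : nat) cop q0).
  rewrite (big_cat_nat (leq0n r) (ltnW rq)) /=.
  rewrite (eq_big_nat _ _ (F2 := fun=> 1)); last by move=> v /andP[_ ->].
  rewrite [X in _ + X]big_nat_cond [X in _ + X]big1 ?addn0 ?sum_nat_const_nat ?subn0 ?muln1 //.
  by move=> v /andP[/andP[rv _] _]; rewrite ltnNge rv.
have := primitive_coprime q0 w_prim; rewrite sum_r => cop_qr.
have [c] := primitive_rotation q0 w_prim; rewrite sum_r => H.
have [n np] := coprime_inverse cop.
have cop_n : coprime n q.
  have : coprime (n * p) q by rewrite -coprime_modl np coprime_modl coprime1n.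
  by rewrite coprimeMl => /andP[].
have r0 : r != 0.
  by apply: contraTneq cop_qr => ->; rewrite /coprime gcdn0; lia.
case: (r =P 1) => [|r1]; first by constructor 1.
case: (r =P q.-1) => [|rq1]; first by constructor 2.
case: (@interval_progression q r (r * n) (r * q.-1 + c)).
- by lia.
- by lia.
- by rewrite coprimeMl coprime_sym cop_qr.
(* The index j = n v - 1, with n inverse to p, makes (j + 1) p equal to v modulo q; [q.-1] stands
   for -1. *)
- move=> v; have := H ((n * v + q.-1) %% q) (ltn_pmod _ q0).
  have -> : (((n * v + q.-1) %% q).+1 * p) %% q = v %% q.
    rewrite -modnMml -addn1 modnDml -addnA addn1 prednK // modnMml mulnDl.
    by rewrite addnC (mulnC q) modnMDl mulnAC -modnMml np modnMml mul1n.
  by rewrite -modnDml modnMmr modnDml mulnDr mulnA addnA => ->.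
- move=> rn; constructor 3.
  by rewrite -[r]muln1 -modnMmr -np modnMmr mulnA -modnMml rn mul1n.
move=> rn; constructor 4.
rewrite /dvdn -modnDml -[X in X %% q + p]muln1 -modnMmr -np modnMmr mulnA -modnMml rn.
by rewrite modnDml -mulSnr prednK // mulnC modnMl.
Qed.

(** * Cyclic words and their decomposition into runs *)

Section CyclicWords.
Local Open Scope group_scope.
Local Notation F2 := (freegroup bool).
Local Notation x := (fggen true : F2).
Local Notation y := (fggen false : F2).

Lemma primitive_shift (n : nat) (F : nat -> F2) k :
  (forall i, F (i + n) = F i) ->
  primitive (\prod_(0 <= i < n) F (i + k)) <-> primitive (\prod_(0 <= i < n) F i).
Proof.
move=> Fn; elim: k => [|k IH].
  by rewrite (eq_bigr F) // => i _; rewrite addn0.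
rewrite -IH; set S := \prod_(_ <= i < _) F (i + k).
suff -> : \prod_(0 <= i < n) F (i + k.+1) = S ^ F k by exact: primitiveJ.
apply: (mulgI (F k)); rewrite conjgE mulVKg.
rewrite -{2}Fn [X in S * F X]addnC -(big_nat_recr n 0 (fun i => F (i + k))) //=.
rewrite big_nat_recl // add0n; congr (_ * _).
by apply: eq_bigr => i _; rewrite addnS.
Qed.

(** Adding c to the points is a cyclic shift of the indices by c / s modulo n. *)
Lemma primitive_rotate (n s c : nat) (F : nat -> F2) :
  coprime s n ->
  primitive (\prod_(0 <= i < n) F ((c + i * s) %% n)) <->
  primitive (\prod_(0 <= i < n) F ((i * s) %% n)).
Proof.
move=> /coprime_inverse[k ks].
rewrite -(@primitive_shift _ (fun i => F ((i * s) %% n)) (c * k)); last first.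
  by move=> i; rewrite mulnDl addnC mulnC modnMDl.
rewrite (eq_bigr (fun i => F (((i + c * k) * s) %% n))) // => i _.
congr (F _).
by rewrite mulnDl -mulnA addnC -[RHS]modnDmr -modnMmr ks modnMmr muln1 modnDmr.
Qed.

Variables (p q : nat).
Hypothesis q0 : 0 < q.
Local Notation N := (p + q).

(* Along the walk 0, p, 2p, ... modulo p + q, the point 0 is followed by runs
   of steps -q, the j-th of which descends from p + (j p mod q) to
   (j + 1) p mod q. *)
Let top j := p + (j * p) %% q.
Let time j := j + (j * p) %/ q.

Let timeS j : time j.+1 = time j + (top j %/ q).+1.
Proof.
by rewrite /time /top mulSn {1}(divn_eq (j * p) q) addnCA divnMDl //; lia.
Qed.

Let walk_run j i : i * q <= top j ->
  ((time j + i).+1 * p) %% N = top j - i * q.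
Proof.
move=> iq; have lt_N : top j - i * q < N.
  by rewrite (leq_ltn_trans (leq_subr _ _)) // ltn_add2l ltn_pmod.
have -> : ((time j + i).+1 * p = ((j * p) %/ q + i) * N + (top j - i * q))%N.
  have := divn_eq (j * p) q; rewrite /time /top in iq lt_N *; nia.
by rewrite modnMDl modn_small.
Qed.

Lemma walk_runs (F : nat -> F2) :
  primitive (\prod_(0 <= i < N) F ((i * p) %% N)) <->
  primitive (\prod_(0 <= j < q) \prod_(0 <= i < (top j %/ q).+1)
               F (top j - i * q)).
Proof.
(* The shift moves the point 0 to the end, so that the product starts at the top of run 0. *)
rewrite -(@primitive_shift _ (fun i => F ((i * p) %% N)) 1); last first.
  by move=> i; rewrite mulnDl addnC mulnC modnMDl.
suff H J : \prod_(0 <= i < time J) F (((i + 1) * p) %% N) =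
    \prod_(0 <= j < J) \prod_(0 <= i < (top j %/ q).+1) F (top j - i * q).
  by rewrite -H /time mulnC mulnK // addnC.
elim: J => [|J IH]; first by rewrite /time div0n !big_geq.
rewrite [RHS]big_nat_recr //= -IH timeS (big_cat_nat (leq0n (time J)) (leq_addr _ _)) /=.
congr (_ * _); rewrite -{1}[time J]add0n big_addn addKn.
apply: eq_big_nat => i /andP[_ iq]; rewrite addn1 addnC walk_run //.
by rewrite -leq_divRL.
Qed.

Let column_lt i v r : v < q -> (i * q + v < r) = (i < r %/ q + (v < r %% q)).
Proof.
move=> vq; have := divn_eq r q; have := ltn_pmod r q0.
set k := r %/ q; set r' := r %% q => r'q ->.
by apply/idP/idP; case: (ltnP v r'); nia.
Qed.

(** The points of a run share their residue v modulo q. Only the last is below q and gives [a];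
    those below r number r / q, plus one if v < r mod q, and come at the end of the run. *)
Lemma walk_word (a b : F2) r : r <= N ->
  primitive (\prod_(0 <= i < N) (b ^+ ((i * p) %% N < r) * a ^+ ((i * p) %% N < q)))
  <-> primitive (bit_word q (fun j => (j.+1 * p) %% q < r %% q)
                           (b ^+ (r %/ q) * a) b).
Proof.
move=> rN; rewrite (walk_runs (fun s => b ^+ (s < r) * a ^+ (s < q))).
suff H j : \prod_(0 <= i < (top j %/ q).+1)
    (b ^+ (top j - i * q < r) * a ^+ (top j - i * q < q)) =
    b ^+ ((j.+1 * p) %% q < r %% q) * (b ^+ (r %/ q) * a).
  by rewrite (eq_bigr _ (fun j _ => H j)).
have -> : (j.+1 * p) %% q = top j %% q by rewrite mulSn -modnDmr.
have p_top : p <= top j by rewrite leq_addr.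
move: (top j) p_top => t pt; set v := t %% q; have vq : v < q by exact: ltn_pmod.
(* The point t + q would be at least p + q >= r, so the run contains every point of its residue
   class below r. *)
have le_m : r %/ q + (v < r %% q) <= (t %/ q).+1.
  rewrite leqNgt -(column_lt _ _ vq) -leqNgt (leq_trans rN) //.
  by rewrite mulSn -addnA -divn_eq addnC leq_add2l.
(* Truncating the exponent at the length of the run makes the induction on this length possible. *)
rewrite mulgA -expgnDr addnC -(minn_idPr le_m) {pt le_m}.
have tE : t = t %/ q * q + v := divn_eq t q.
move: (t %/ q) tE => m; clearbody v => -> {t}; elim: m => [|m IH].
  have := column_lt 0 r vq; rewrite big_nat1 mul0n add0n subn0 vq => ->.
  rewrite expg1; congr (b ^+ _ * _); move: (_ + _)%N => K; lia.
rewrite big_nat_recl // subn0 column_lt //.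
have -> : (m.+1 * q + v < q) = false by nia.
rewrite mulg1 (eq_bigr (fun i =>
  b ^+ (m * q + v - i * q < r) * a ^+ (m * q + v - i * q < q))); last first.
  by move=> i _; rewrite !mulSn -addnA subnDl.
rewrite IH mulgA -expgnDr; congr (b ^+ _ * _).
by case: ltnP; lia.
Qed.

End CyclicWords.

(** * The primitivity criterion, by the Euclidean algorithm *)

Section PrimitiveWords.
Local Open Scope group_scope.
Local Notation F2 := (freegroup bool).
Local Notation x := (fggen true : F2).
Local Notation y := (fggen false : F2).

Lemma bit_word_basis q eps (a b : F2) : basis a b ->
  primitive (bit_word q eps a b) <-> primitive (bit_word q eps x y).
Proof.
case=> f [f_bij <- <-].
suff -> : bit_word q eps (f x) (f y) = f (bit_word q eps x y).
  exact: primitive_endo.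
rewrite /bit_word (big_morph f (@gmulfM _ _ f) (multiplicative1 f)).
by apply: eq_bigr => j _; rewrite gmulfM; case: (eps j); rewrite ?multiplicative1.
Qed.

(** The substitution x -> y x, y -> y^-1 turns y^e x into y^(1 - e) x. *)
Lemma bit_word_compl q eps : primitive (bit_word q (fun j => ~~ eps j) x y) <->
  primitive (bit_word q eps x y).
Proof.
rewrite -(bit_word_basis q eps (basisVr (basisMl basis_gen))).
rewrite /bit_word (eq_bigr (fun j => y^-1 ^+ eps j * (y * x))) // => j _.
by case: (eps j); rewrite ?expg0 ?expg1 ?mulKg ?mul1g.
Qed.

Definition rotation_word q p r c :=
  bit_word q (fun j => (c + j * p) %% q < r) x y.

Lemma rotation_word_shift q p r c : coprime p q ->
  primitive (rotation_word q p r c) <-> primitive (rotation_word q p r 0).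
Proof.
by move=> cop; rewrite /rotation_word /bit_word
  (primitive_rotate c (fun v => y ^+ (v < r) * x) cop).
Qed.

(** The complement of [0, r) in Z/q is a translate of [0, q - r). *)
Lemma rotation_word_compl q p r : coprime p q -> 0 < q -> r <= q ->
  primitive (rotation_word q p (q - r) 0) <-> primitive (rotation_word q p r 0).
Proof.
move=> cop q0 rq.
rewrite -(rotation_word_shift (q - r) (q - r) cop) -bit_word_compl.
rewrite /rotation_word /bit_word (eq_bigr (fun j => y ^+ ((0 + j * p) %% q < r) * x)) // => j _.
congr (y ^+ nat_of_bool _ * _); rewrite -modnDmr add0n.
have := ltn_pmod (j * p) q0; move: (_ %% q) => v vq.
case: (ltnP v r) => vr; first by rewrite modn_small ?ltnNge //; lia.
by rewrite (_ : q - r + v = q + (v - r))%N ?modnDl ?modn_small; lia.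
Qed.

Lemma rotation_word1 q p : coprime p q -> 1 < q -> primitive (rotation_word q p 1 0).
Proof.
move=> cop q1; have q0 := ltnW q1.
(* The shift by p puts the only y in the last block: x^(q-1) y x is conjugate to x^q y. *)
rewrite -(rotation_word_shift 1 p cop) /rotation_word /bit_word.
rewrite -(prednK q0) big_nat_recr //= prednK //.
rewrite (eq_big_nat _ _ (F2 := fun=> x)); last first.
  move=> j /andP[_ jq]; rewrite -mulSn ltnS leqn0 -/(dvdn _ _) Gauss_dvdl 1?coprime_sym //.
  by rewrite gtnNdvd ?mul1g // -[q in _ < q](prednK q0) ltnS.
rewrite prodg_const_nat subn0 -mulSn prednK // modnMr expg1 mulgA.
apply/primitiveC; rewrite mulgA -expgS prednK //.
exact: basis_primitive (basisXl q (basis_swap basis_gen)).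
Qed.

(** For coprime p and q, a Christoffel word with q letters [a] and p letters [b]. *)
Definition lattice_word p q (a b : F2) :=
  \prod_(0 <= i < p + q) (if (i * p) %% (p + q) < q then a else b).

Lemma lattice_word_basis p q (a b : F2) : basis a b ->
  primitive (lattice_word p q a b) <-> primitive (lattice_word p q x y).
Proof.
case=> f [f_bij <- <-].
suff -> : lattice_word p q (f x) (f y) = f (lattice_word p q x y).
  exact: primitive_endo.
rewrite /lattice_word (big_morph f (@gmulfM _ _ f) (multiplicative1 f)).
by apply: eq_bigr => j _; case: ifP.
Qed.

(** As q = -p modulo p + q, the reflection s -> p + q - 1 - s carries one walk to a shift of the
    other and exchanges the two letters. *)
Lemma lattice_word_swap p q : coprime p q ->
  primitive (lattice_word q p x y) <-> primitive (lattice_word p q x y).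
Proof.
move=> cop; have [N0|N0] := posnP (p + q); first by rewrite /lattice_word addnC N0 !big_geq.
rewrite -(lattice_word_basis q p (basis_swap basis_gen)) /lattice_word addnC.
rewrite -(primitive_rotate (p + q).-1 (fun v => if v < p then y else x)); last first.
  by rewrite /coprime gcdnDr -/(coprime _ _) coprime_sym.
rewrite (eq_bigr (fun i => if (i * p) %% (p + q) < q then x else y)) // => i _.
rewrite -if_neg; congr (if _ then _ else _).
have u_lt := ltn_pmod (i * p) N0.
have u0 : (i * q + (i * p) %% (p + q)) %% (p + q) = 0.
  by rewrite modnDmr -mulnDr (addnC q) modnMl.
have -> : ((p + q).-1 + i * q = (p + q).-1 - (i * p) %% (p + q)
     + (i * q + (i * p) %% (p + q)))%N by lia.
by rewrite -modnDmr u0 addn0 modn_small; lia.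
Qed.

(** After x -> y x this is [walk_word] with r = p + q. *)
Lemma lattice_word_mod p q : 0 < q ->
  primitive (lattice_word p q x y) <-> primitive (rotation_word q p (p %% q) p).
Proof.
move=> q0; rewrite -(lattice_word_basis p q (basisMl basis_gen)).
have := walk_word q0 x y (leqnn (p + q)).
rewrite modnDr divnDr // divnn q0.
rewrite (bit_word_basis q _ (basisXl _ basis_gen)) => <-.
rewrite /lattice_word (eq_bigr (fun i => y ^+ ((i * p) %% (p + q) < p + q)
   * x ^+ ((i * p) %% (p + q) < q))) // => i _.
rewrite ltn_pmod ?addn_gt0 ?q0 ?orbT //.
by case: ifP; rewrite ?mulg1.
Qed.

(** The rotation word depends on p only modulo q, so p may be reduced to p mod q and the letters
    swapped, until q = 0 and p = 1. *)
Lemma lattice_word_primitive p q : coprime p q -> primitive (lattice_word p q x y).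
Proof.
have [n] := ubnP q; elim: n p q => // n IH p q; rewrite ltnS => qn cop.
case: (posnP q) => [q0|q0].
  move: cop; rewrite q0 /coprime gcdn0 => /eqP ->.
  rewrite /lattice_word big_nat1.
  exact: basis_primitive (basis_swap basis_gen).
have cop' : coprime q (p %% q) by rewrite coprime_sym coprime_modl.
have := IH q (p %% q) (leq_trans (ltn_pmod p q0) qn) cop'.
rewrite lattice_word_swap; last by rewrite coprime_sym.
rewrite !lattice_word_mod // modn_mod; apply: iffLR.
rewrite /rotation_word /bit_word.
rewrite (eq_bigr (fun j => y ^+ ((p + j * p) %% q < p %% q) * x)) // => j _.
by rewrite modnDml -modnDmr modnMmr modnDmr.
Qed.

(** For sufficiency, r = 1 is explicit, r = p gives a lattice word, and complements give the
    opposite residues. *)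
Lemma rotation_word_primitive q p r : coprime p q -> 1 < q -> r < q ->
  primitive (rotation_word q p r p) <->
  [\/ r = 1%N, r = q.-1, r = p %[mod q] | (q %| r + p)%N].
Proof.
move=> cop q1 rq; have q0 := ltnW q1.
split=> [|H]; first exact: primitive_rotation_word.
rewrite rotation_word_shift //; case: H => [->|->|rp|rp].
- exact: rotation_word1.
- by rewrite -subn1 rotation_word_compl //; exact: rotation_word1.
- rewrite -(rotation_word_shift _ p cop) -(modn_small rq) rp -lattice_word_mod //.
  exact: lattice_word_primitive.
rewrite -rotation_word_compl 1?ltnW //.
rewrite (_ : q - r = p %% q)%N; last first.
  case: (posnP r) => [r0|r0].
    move: rp; rewrite r0 add0n => /gcdn_idPl; rewrite gcdnC (eqP cop).
    by move=> e; rewrite -e in q1.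
  have : (q %| r + p %% q)%N by rewrite /dvdn modnDmr.
  have := ltn_pmod p q0; move: (p %% q)%N => v vq /dvdnP[[|[|k]]]; lia.
rewrite -(rotation_word_shift _ p cop) -lattice_word_mod //.
exact: lattice_word_primitive.
Qed.

Lemma twisted_word_primitive p q r (b : F2) :
  coprime p q -> 1 < q -> r <= p + q -> basis x b ->
  primitive (\prod_(0 <= i < p + q)
     (b ^+ ((i * p) %% (p + q) < r) * x ^+ ((i * p) %% (p + q) < q))) <->
  [\/ r = 1 %[mod q], r = q.-1 %[mod q], r = p %[mod q] | (q %| r + p)%N].
Proof.
move=> cop q1 rN xb; have q0 := ltnW q1.
rewrite walk_word // bit_word_basis; last exact: basisXl.
rewrite (rotation_word_primitive cop q1 (ltn_pmod r q0)) modn_mod.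
rewrite (modn_small q1) (modn_small (_ : q.-1 < q)) ?prednK //.
by rewrite /dvdn modnDml.
Qed.

End PrimitiveWords.

(** * Integer solutions of the two congruences *)

Section Triples.
Local Open Scope ring_scope.
Implicit Types p q r : int.

Definition hyper_congruence p q r := exists k : int,
  [\/ r - 1 = k * p, r + 1 = k * p, r - q = k * p | r + q = k * p].

Lemma listed_hyper_congruence p q r : listed_triple (p, q, r) ->
  hyper_congruence p q r /\ hyper_congruence q p r.
Proof.
case=> [[p' [q' [-> -> ->]]]|[p' [q' [-> -> ->]]]|].
- by split; exists 1; constructor 3; ring.
- split; first by exists 1; constructor 4; ring.
  by exists (-1); constructor 3; ring.
case=> [[d [i [j [[] -> _ _ [-> -> ->]]]]]|[d [j [[] -> _ [-> -> ->]]]]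
       |[d [j [k [[] -> _ _ _ [-> -> ->]]]]]].
- split; first by exists 1; constructor 2; lia.
  by exists (2 * i + 1); constructor 4; lia.
- split; first by exists 1; constructor 1; lia.
  by exists (2 * i + 1); constructor 4; lia.
- split; first by exists 2; constructor 4; lia.
  by exists 2; constructor 1; lia.
- split; first by exists 2; constructor 4; lia.
  by exists 2; constructor 2; lia.
- split; first by exists 1; constructor 2; lia.
  by exists k; constructor 1; lia.
split; first by exists 1; constructor 1; lia.
by exists k; constructor 2; lia.
Qed.

Lemma int_parity (a : int) : exists b, a = 2 * b \/ a = 2 * b + 1.
Proof. by exists (a %/ 2)%Z; lia. Qed.

Section Classification.
Variables p q r : int.
Hypotheses (q_ge2 : 2 <= q) (q_lt_p : q < p).
Hypotheses (r_ge2 : 2 <= r) (r_le : r <= p + q).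
Hypothesis cop : forall d a b : int, p = d * a -> q = d * b -> d < 2.

Let pNdiv (k : int) : p <> k * q.
Proof. by move=> pk; have := @cop q k 1; rewrite mulrC mulr1; lia. Qed.

Let q_ndiv1 (k : int) : k * q <> 1.
Proof.
move=> kq; have [?|[?|?]] : k <= -1 \/ k = 0 \/ 1 <= k by lia.
- by nia.
- by lia.
by nia.
Qed.

Let listed3 (d l : int) : is_sign d -> 2 * p = l * q + d -> r = p - d ->
  listed_triple (p, q, r).
Proof.
move=> d1 pE rE; have [j qj] := int_parity q; have [i li] := int_parity l.
constructor 3; constructor 1; exists d, i, j.
have [qE lE] : q = 2 * j + 1 /\ l = 2 * i + 1.
  by case: d1 qj li pE => -> [] -> [] -> pE; split=> //; lia.
split=> //; try by nia.
by case: d1 pE rE => -> pE rE; congr (_, _, _); lia.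
Qed.

Let listed4 e : is_sign e -> 2 * p = 3 * q + e -> r = 2 * q + e ->
  listed_triple (p, q, r).
Proof.
move=> e1 pE rE; have [j qj] := int_parity q.
constructor 3; constructor 2; exists e, j.
have qE : q = 2 * j + 1 by case: e1 pE => ->; lia.
split=> //; first by lia.
by case: e1 pE rE => -> pE rE; congr (_, _, _); lia.
Qed.

Let listed5 (e k : int) : is_sign e -> p = k * q + 2 * e -> r = k * q + e ->
  listed_triple (p, q, r).
Proof.
move=> e1 pE rE; have [j qj] := int_parity q.
have qE : q = 2 * j + 1.
  case: qj => // qE; have := @cop 2 (k * j + e) j; lia.
constructor 3; constructor 3; exists e, j, k.
have k1 : 1 <= k by case: e1 pE => ->; nia.
split=> //; first by lia.
(* The excluded parameters would give p = 1 and q = 3, against q < p. *)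
- by case=> jE kE eE; lia.
by congr (_, _, _); lia.
Qed.

(** Since r <= p + q < 2 p, the quotient k is 0, 1 or 2, leaving six values of r. Of these p + q and
    p - q are types 1 and 2, the second congruence puts p + 1 and p - 1 in types 3 and 5 and 2 p - q
    in type 4, and it excludes q. *)
Lemma hyper_congruence_listed :
  hyper_congruence p q r -> hyper_congruence q p r -> listed_triple (p, q, r).
Proof.
move=> [k hk] [l hl].
have p1 : is_sign 1 by left.
have m1 : is_sign (-1) by right.
have k0 : 0 <= k by case: hk; nia.
have k2 : k <= 2 by case: hk; nia.
have rE : [\/ r = p + 1, r = p - 1, r = q | r = p - q] \/
          (r = p + q \/ r = 2 * p - q).
  have kE : k = 0 \/ k = 1 \/ k = 2 by lia.
  case: kE hk => [->|[->|->]] [] hk;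
  first [by left; constructor 1; lia | by left; constructor 2; lia
    | by left; constructor 3; lia | by left; constructor 4; lia
    | by right; left; lia | by right; right; lia].
case: rE => [[] rE|[rE|rE]].
- case: hl => hl.
  + by case: (@pNdiv l); lia.
  + by apply: (@listed5 _ l m1); lia.
  + by case: (@q_ndiv1 l); lia.
  + by apply: (@listed3 _ l m1); lia.
- case: hl => hl.
  + by apply: (@listed5 _ l p1); lia.
  + by case: (@pNdiv l); lia.
  + by case: (@q_ndiv1 (- l)); lia.
  + by apply: (@listed3 _ l p1); lia.
- case: hl => hl.
  + by case: (@q_ndiv1 (1 - l)); lia.
  + by case: (@q_ndiv1 (l - 1)); lia.
  + by case: (@pNdiv (1 - l)); lia.
  + by case: (@pNdiv (l - 1)); lia.
- by rewrite rE; constructor 2; exists p, q.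
- by rewrite rE; constructor 1; exists p, q.
case: hl => hl.
- have l2 : l = 2 by nia.
  by apply: (listed4 p1); lia.
- have [l2|l3] : l = 2 \/ l = 3 by nia.
    by apply: (listed4 m1); lia.
  by lia.
- by case: (@pNdiv (l + 1)); lia.
(* Now 3 p = (l + 1) q, so coprimality leaves (4, 3, 5) and (5, 3, 7), both of type 4. *)
have [l3|[l4|l5]] : l = 3 \/ l = 4 \/ l = 5 by nia.
- by have := @cop (p - q) 4 3 => H; apply: (listed4 m1); lia.
- by have := @cop (2 * q - p) 5 3 => H; apply: (listed4 p1); lia.
by case: (@pNdiv 2); lia.
Qed.

End Classification.


Lemma hyper_congruenceP (p q r : int) :
  [\/ (r = 1 %[mod p])%Z, (r = - 1 %[mod p])%Z,
      (r = q %[mod p])%Z | (r = - q %[mod p])%Z] <-> hyper_congruence p q r.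
Proof.
have modP a b : (a = b %[mod p])%Z <-> exists k, a - b = k * p.
  split=> [/eqP|e]; first by rewrite eqz_mod_dvd => /dvdzP.
  by apply/eqP; rewrite eqz_mod_dvd; apply/dvdzP.
split.
  by case=> /modP[k]; rewrite ?opprK => hk; exists k;
     [constructor 1|constructor 2|constructor 3|constructor 4].
by case=> k []hk; [constructor 1|constructor 2|constructor 3|constructor 4];
   apply/modP; exists k; rewrite ?opprK.
Qed.

Lemma or4_iff (A A' B B' C C' D D' : Prop) :
  (A <-> A') -> (B <-> B') -> (C <-> C') -> (D <-> D') ->
  [\/ A, B, C | D] <-> [\/ A', B', C' | D'].
Proof.
move=> AA BB CC DD; split=> -[/AA|/BB|/CC|/DD] H;
by [constructor 1|constructor 2|constructor 3|constructor 4].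
Qed.

Lemma hyper_congruence_nat (p q r : nat) : (0 < q)%N ->
  [\/ r = 1 %[mod q], r = q.-1 %[mod q], r = p %[mod q] | (q %| r + p)%N] <->
  hyper_congruence q p r.
Proof.
move=> q0; rewrite -hyper_congruenceP.
have modE a b : (Posz a = Posz b %[mod q])%Z <-> a = b %[mod q].
  by rewrite !modz_nat; split=> [[]|->].
apply: or4_iff; first by rewrite -modE.
- by rewrite -modE -[((- 1) %% q)%Z]modzDl -predn_int.
- by rewrite -modE.
by split=> [?|/eqP]; [apply/eqP|]; rewrite eqz_mod_dvd opprK -PoszD.
Qed.

End Triples.

(** * From the knot to its word *)

Section CurveWord.
Local Open Scope group_scope.

(** For |n| = 1 only the point 0 crosses [Disk_W'], and it is visited only at i = 0. *)
Lemma torus_knot_class m n : n = 1%R \/ n = (- 1)%R ->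
  pi1_H'_class (torus_knot Disk_W Disk_W' m n) = pi1_H'_letter (Disk_W', (0 < n)%R).
Proof.
move=> n1; have nE : `|n|%N = 1%N by case: n1 => ->.
rewrite /pi1_H'_class /torus_knot big_map nE addn1 /= big_cons.
rewrite {1}/strand_crossing nE /strand mul0n mod0n /=.
rewrite big_seq big1 ?mulg1 // => i; rewrite mem_iota add1n ltnS => /andP[i0 im].
rewrite /strand_crossing nE /strand addn1 ltnS leqn0 -/(dvdn _ _).
by rewrite Gauss_dvdl ?coprimeSn // gtnNdvd //; case: (0 < n)%R.
Qed.

Lemma twisted_torus_knot_class (p q r : nat) (m n : int) :
  (0 < q)%N -> n = 1%R \/ n = (- 1)%R ->
  pi1_H'_class (twisted_torus_knot p q r m n) =
  \prod_(0 <= i < p + q)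
    (pi1_H'_letter (Disk_W', (0 < n)%R) ^+ ((i * p) %% (p + q) < r)
     * fggen true ^+ ((i * p) %% (p + q) < q)).
Proof.
move=> q0 n1; rewrite /pi1_H'_class /twisted_torus_knot big_flatten big_map /index_iota subn0.
apply: eq_bigr => i _; rewrite big_cat big_seq1 /=; congr (_ * _); last first.
  by rewrite /strand_crossing /strand /=; case: ifP => //= _; rewrite ltz_nat q0.
rewrite /strand; case: ifP => _; last by rewrite big_nil.
exact: torus_knot_class.
Qed.

Lemma primitive_wrt_H'P (p q r : nat) (m n : int) :
  coprime p q -> (1 < q)%N -> (r <= p + q)%N -> n = 1%R \/ n = (- 1)%R ->
  primitive_wrt_H' p q r m n <-> hyper_congruence q p r.
Proof.
move=> cop q1 rN n1; have q0 := ltnW q1.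
rewrite /primitive_wrt_H' twisted_torus_knot_class // -hyper_congruence_nat //.
apply: twisted_word_primitive => //.
(* The sign of n merely replaces the basis (x, y) by (x, y^-1). *)
by case: n1 => -> /=; [|apply: basisVr]; exact: basis_gen.
Qed.

End CurveWord.

Theorem theorem5 (p q r : nat) (m n : int)
    (hp : (3 <= p)%N) (hq : (2 <= q)%N) (hpq : coprime p q)
    (hr : (2 <= r <= p + q)%N)
    (hm : m <> 0%R) (hn : n = 1%R \/ n = (- 1)%R) :
  hyper_Seifert_wrt_H p q r m n /\ primitive_wrt_H' p q r m n <->
  (1 < `|m|)%R /\
  (listed_triple (Posz p, Posz q, Posz r) \/
   listed_triple (Posz q, Posz p, Posz r)).
Proof.
have /andP[r2 rN] := hr.
rewrite /hyper_Seifert_wrt_H hyper_congruenceP primitive_wrt_H'P //.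
suff -> : (listed_triple (Posz p, Posz q, Posz r) \/
           listed_triple (Posz q, Posz p, Posz r)) <->
    hyper_congruence p q r /\ hyper_congruence q p r by tauto.
split=> [[] /listed_hyper_congruence [] //|[pqr qpr]].
have cop (d a b : int) : Posz p = (d * a)%R -> Posz q = (d * b)%R -> (d < 2)%R.
  move=> pE qE; have : (`|d| %| gcdn p q)%N.
    by rewrite dvdn_gcd -[p]absz_nat -[q]absz_nat pE qE !abszM !dvdn_mulr.
  by rewrite (eqP hpq) dvdn1; lia.
(* The pair of congruences is symmetric in p and q, and coprimality excludes p = q. *)
have [qp|pq] := ltnP q p; [left|right].
  by apply: hyper_congruence_listed => //; lia.
apply: hyper_congruence_listed => //; try lia.
- have : p != q by apply: contraTneq hpq => ->; rewrite /coprime gcdnn; lia.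
  by lia.
by move=> d a b pE qE; exact: (cop d b a).
Qed.
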